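(* Let $(J,\{,,\},\alpha)$ be a Hom-Jordan triple system with equal twisting maps (both equal to $\alpha$). Define the triple product $$[xyz]=\{xyz\}-\{yxz\}$$ for $x,y,z\in J$. Then $L(J)=(J,[,,],\alpha)$ is a Hom-Lie triple system. Moreover, if $J$ is multiplicative, then so is $L(J)$.
   Context: We work over a fixed field $\mathbf{k}$ of characteristic $0$. A ternary Hom-algebra $(V,(,,),(\alpha_1,\alpha_2))$ consists of a $\mathbf{k}$-module $V$, a trilinear map $(,,)\colon V^{\otimes 3}\to V$, written $(xyz)$, and linear maps $\alpha_1,\alpha_2\colon V\to V$ (the twisting maps). When $\alpha_1=\alpha_2=\alpha$ we write $(V,(,,),\alpha)$. It is multiplicative if $\alpha_1=\alpha_2=\alpha$ and $\alpha\circ(,,)=(,,)\circ\alpha^{\otimes 3}$. The triple product may be denoted by other brackets. A Hom-Jordan triple system is a ternary Hom-algebra $(J,\{,,\},(\alpha_1,\alpha_2))$ with $\{xyz\}=\{zyx\}$ and $$\{\alpha_1(x)\alpha_2(y)\{uvw\}\}-\{\alpha_1(u)\alpha_2(v)\{xyw\}\}=\{\{xyu\}\alpha_1(v)\alpha_2(w)\}-\{\alpha_1(u)\{yxv\}\alpha_2(w)\}$$ for all $u,v,w,x,y,z\in J$. A Hom-Lie triple system is a ternary Hom-algebra $(L,[,,],(\alpha_1,\alpha_2))$ with $[uvw]=-[vuw]$, $[uvw]+[wuv]+[vwu]=0$, and $$[\alpha_1(x)\alpha_2(y)[uvw]]=[[xyu]\alpha_1(v)\alpha_2(w)]+[\alpha_1(u)[xyv]\alpha_2(w)]+[\alpha_1(u)\alpha_2(v)[xyw]]$$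 for all $u,v,w,x,y\in L$. *)

(* Defs.v *)
From HB Require Import structures.
From mathcomp Require Import all_boot all_order all_algebra.

Set Implicit Arguments.
Unset Strict Implicit.
Unset Printing Implicit Defensive.

Import GRing.Theory.
Local Open Scope ring_scope.

Section TernaryHomAlgebras.
Variables (k : fieldType) (V : lmodType k).
Implicit Types (t : V -> V -> V -> V) (a : {linear V -> V}).

Definition trilinear t : Prop :=
  [/\ forall y z, linear (fun x => t x y z),
      forall x z, linear (fun y => t x y z)
    & forall x y, linear (fun z => t x y z)].

Definition multiplicative_Hom t a1 a2 : Prop :=
  a1 =1 a2 /\ (forall x y z, a1 (t x y z) = t (a1 x) (a1 y) (a1 z)).

Definition Hom_Jordan_triple_system t a1 a2 : Prop :=
  [/\ trilinear t,
      forall x y z, t x y z = t z y x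
    & forall u v w x y,
        t (a1 x) (a2 y) (t u v w) - t (a1 u) (a2 v) (t x y w)
        = t (t x y u) (a1 v) (a2 w) - t (a1 u) (t y x v) (a2 w)].

Definition Hom_Lie_triple_system t a1 a2 : Prop :=
  [/\ trilinear t,
      forall u v w, t u v w = - t v u w,
      forall u v w, t u v w + t w u v + t v w u = 0
    & forall u v w x y,
        t (a1 x) (a2 y) (t u v w)
        = t (t x y u) (a1 v) (a2 w) + t (a1 u) (t x y v) (a2 w)
          + t (a1 u) (a2 v) (t x y w)].

Definition Lie_product t (x y z : V) : V := t x y z - t y x z.

End TernaryHomAlgebras.

(* Main.v *)
(** Exchanging [x] and [y] in the Hom-Jordan identity and subtracting, the
    operator [[x y -]] becomes an [alpha]-twisted derivation of the Jordan
    product, hence also of its antisymmetrization. *)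
Require Import Defs.
From HB Require Import structures.
From mathcomp Require Import all_boot all_order all_algebra.

Set Implicit Arguments.
Unset Strict Implicit.
Unset Printing Implicit Defensive.

Import GRing.Theory.
Local Open Scope ring_scope.

Section LieProduct.
Variables (k : fieldType) (V : lmodType k) (t : V -> V -> V -> V).

Lemma linear_sub_fun (U : lmodType k) (f g : U -> V) :
  linear f -> linear g -> linear (fun x => f x - g x).
Proof.
by move=> flin glin c x y; rewrite flin glin scalerBr opprD addrACA.
Qed.

Lemma Lie_product_trilinear : trilinear t -> trilinear (Lie_product t).
Proof.
case=> lin1 lin2 lin3; split=> x y; rewrite /Lie_product.
(* The subtracted term has its first two arguments exchanged, so linearity in slot one of the
   bracket uses slot two of [t] there, and conversely. *)
- exact: linear_sub_fun (lin1 x y) (lin2 x y).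
- exact: linear_sub_fun (lin2 x y) (lin1 x y).
- exact: linear_sub_fun (lin3 x y) (lin3 y x).
Qed.

Lemma Lie_product_anti x y z : Lie_product t x y z = - Lie_product t y x z.
Proof. by rewrite /Lie_product opprB. Qed.

(** Reading [t w v u], [t w u v] and [t v w u] backwards turns the six terms into three cancelling
    pairs. *)
Lemma Lie_product_cyclic :
  (forall x y z, t x y z = t z y x) ->
  forall u v w, Lie_product t u v w + Lie_product t w u v
                + Lie_product t v w u = 0.
Proof.
move=> tC u v w; rewrite /Lie_product (tC w v u) (tC w u v) (tC v w u).
by rewrite !addrA !subrK subrr.
Qed.

Variable a : V -> V.
Hypothesis t_linear : trilinear t.

(** In the Jordan identity the middle slot carries [t y x v] with a minus sign. Subtracting the
    instance with [x] and [y] exchanged turns this into [t x y v - t y x v], the bracket with the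
    sign of a Leibniz rule. The product being differentiated is still [t]. *)
Lemma Lie_product_derivation :
  (forall u v w x y,
      t (a x) (a y) (t u v w) - t (a u) (a v) (t x y w)
      = t (t x y u) (a v) (a w) - t (a u) (t y x v) (a w)) ->
  forall u v w x y,
    Lie_product t (a x) (a y) (t u v w)
    = t (Lie_product t x y u) (a v) (a w)
      + t (a u) (Lie_product t x y v) (a w)
      + t (a u) (a v) (Lie_product t x y w).
Proof.
case: t_linear => lin1 lin2 lin3 Jid u v w x y; rewrite /Lie_product.
rewrite (zmod_morphism_linear (lin1 _ _)) (zmod_morphism_linear (lin2 _ _)).
(* With the last summand moved to the left, the four terms there regroup into the left-hand sides of
   the Jordan identity for [x, y] and for [y, x]. *)
rewrite (zmod_morphism_linear (lin3 _ _)); apply/eqP; rewrite -subr_eq; apply/eqP.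
rewrite opprD addrACA -opprD Jid Jid opprB addrACA.
by rewrite [RHS]addrACA [X in _ = _ + X]addrC.
Qed.

(** The rule for [t u v w] minus the rule for [t v u w] antisymmetrizes every summand. *)
Lemma Lie_product_derivation_anti :
  (forall u v w x y,
    Lie_product t (a x) (a y) (t u v w)
    = t (Lie_product t x y u) (a v) (a w)
      + t (a u) (Lie_product t x y v) (a w)
      + t (a u) (a v) (Lie_product t x y w)) ->
  forall u v w x y,
    Lie_product t (a x) (a y) (Lie_product t u v w)
    = Lie_product t (Lie_product t x y u) (a v) (a w)
      + Lie_product t (a u) (Lie_product t x y v) (a w)
      + Lie_product t (a u) (a v) (Lie_product t x y w).
Proof.
have [_ _ lin3] := Lie_product_trilinear t_linear.
move=> der u v w x y; rewrite [Lie_product t u v w]/Lie_product.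
rewrite (zmod_morphism_linear (lin3 _ _)) !der.
(* The rule for [t v u w] differentiates [v] first; the swap aligns its summands with those for
   [t u v w]. *)
rewrite [t (Lie_product t x y v) _ _ + _]addrC.
by rewrite opprD addrACA opprD [X in X + _]addrACA.
Qed.

End LieProduct.

Theorem theorem4p2 (k : fieldType) (char0 : [pchar k] =i pred0)
    (J : lmodType k) (t : J -> J -> J -> J) (alpha : {linear J -> J})
    (HJ : Hom_Jordan_triple_system t alpha alpha) :
  Hom_Lie_triple_system (Lie_product t) alpha alpha
  /\ (multiplicative_Hom t alpha alpha ->
      multiplicative_Hom (Lie_product t) alpha alpha).
Proof.
case: HJ => t_linear tC Jid; split; last first.
  case=> _ tM; split=> // x y z.
  by rewrite /Lie_product linearB !tM.
split.
- exact: Lie_product_trilinear.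
- exact: Lie_product_anti.
- exact: Lie_product_cyclic.
- exact/Lie_product_derivation_anti/Lie_product_derivation.
Qed.
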